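(* Work in Scenario 2 with a common prior, and assume that each $v_i$ has a density on $[\underline v_i,\bar v_i]$ and that for each $i$ the map $g_i(v)=v-\sum_{j\ne i}\mathbb E[\eta_{j\leftarrow i}\mid v_i=v]$ is non-decreasing on $[\underline v_i,\bar v_i]$. Let $\tau_i=\inf\{v\in[\underline v_i,\bar v_i]:g_i(v)\ge0\}$ (with $\inf\emptyset:=\bar v_i$). Define the mechanism: for $\mathbf t\in T$, $x_i(\mathbf t)=\mathbf 1\{g_i(v_i)\ge 0\}$; when bidder $i$ abstains, $x_i=p_i=0$ and $x_j(\emptyset,\mathbf t_{-i})=\mathbf 1\{v_j\ge\sum_{k\in N\setminus\{i,j\}}\mathbb E[\eta_{k\leftarrow j}\mid v_j]\}$ for $j\neq i$; and $$p_i(\mathbf t)=\tau_i\,x_i(\mathbf t)-\sum_{j\ne i}\mathbb E\big[\eta_{i\leftarrow j}\,x_j(\mathbf t)\big]-C_i,$$ where the expectation is over $t_j\sim F_j$ (so it is a constant), and $C_i$ is a constant with $C_i\ge c_i^\emptyset:=-\sum_{j\ne i}\mathbb E\big[\eta_{i\leftarrow j}\,x_j(\emptyset,\mathbf t_{-i})\big]$. Then: (a) this mechanism (with payments allowed to be real numbers) is BNIC and interim IR, and for $C_i=c_i^\emptyset$ all payments are nonnegative; (b) for every BNIC mechanism $(\mathbf x',\mathbf p')$, $\mathbb E[\mathrm{SW}(\mathbf x'(\mathbf t);\mathbf t)]\le\mathbb E[\mathrm{SW}(\mathbf x(\mathbf t);\mathbf t)]$, where $\mathrm{SW}(\mathbf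 z;\mathbf t)=\sum_{i\in N}\nu_i(\mathbf z)=\sum_{i\in N}\big(v_i-\sum_{j\ne i}\eta_{j\leftarrow i}\big)z_i$.
   Context: Model: there are $n$ bidders $N=\{1,\dots,n\}$ and a seller of a freely replicable good; an allocation is any $\mathbf x\in[0,1]^n$. Bidder $i$ has value $v_i\in[\underline v_i,\bar v_i]\subset\mathbb R_{\ge0}$ and for $j\ne i$ parameters $\eta_{i\leftarrow j}\in[\underline\eta_{i\leftarrow j},\bar\eta_{i\leftarrow j}]\subset\mathbb R_{\ge0}$; valuation $\nu_i(\mathbf x)=v_ix_i-\sum_{j\ne i}\eta_{i\leftarrow j}x_j$, utility $\nu_i(\mathbf x)-p_i$. In Scenario 2, bidder $i$'s private type is $t_i=(v_i,(\eta_{j\leftarrow i})_{j\ne i})\in T_i=[\underline v_i,\bar v_i]\times\prod_{j\ne i}[\underline\eta_{j\leftarrow i},\bar\eta_{j\leftarrow i}]$ (she knows the externalities she exerts on others). Bids lie in $B_i=T_i\cup\{\emptyset\}$; a mechanism is $\mathbf x:B\to[0,1]^n$, $\mathbf p:B\to\mathbb R^n_{\ge0}$ with $x_i=p_i=0$ when $i$ bids $\emptyset$, specified on profiles with at most one $\emptyset$. Common prior: types $t_i\sim F_i$ are independent across bidders. Interim utility: $V_i(\hat t_i;t_i)=\mathbb E[u_i(\mathbf x(\hat t_i,\mathbf t_{-i}),p_i(\hat t_i,\mathbf t_{-i});\mathbf t)\mid t_i]$ with $\mathbf t_{-i}\sim\prod_{j\ne i}F_j$ (others truthful), for $\hat t_i\in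 B_i$. BNIC: $V_i(t_i;t_i)\ge V_i(\hat t_i;t_i)$ for all $i$ and $t_i,\hat t_i\in T_i$. Interim IR: $V_i(t_i;t_i)\ge V_i(\emptyset;t_i)$ for all $i,t_i$. *)

(* Defs.v *)
From HB Require Import structures.
From mathcomp Require Import all_boot all_order all_algebra.
From mathcomp Require Import all_classical all_reals all_analysis.

Set Implicit Arguments.
Unset Strict Implicit.
Unset Printing Implicit Defensive.

Import Order.TTheory GRing.Theory Num.Theory.
Local Open Scope classical_set_scope.
Local Open Scope ring_scope.

(*  Bidders are 'I_n.  A (raw) type of a bidder is an element of              *)
(*     Ty R n := R * n.-tuple R,                                              *)
(*  where for bidder i with type t, t.1 = v_i and tnth t.2 j = eta_{j<-i}     *)
(*  (the externality bidder i exerts on bidder j).  The coordinate            *)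
(*  tnth t.2 i is meaningless and normalised to 0 in the type space T_i.      *)
(*  Bounds: lv i, uv i bound v_i; le j i, ue j i bound eta_{j<-i}.            *)
(*  A bid of bidder i is an option (Ty R n): None is the abstention bid.      *)
(*  A type profile is an n.-tuple of types; a bid profile is 'I_n -> option.  *)

Notation Ty R n := (R * n.-tuple R)%type.

Definition Tset (R : realType) (n : nat) (lv uv : 'I_n -> R)
  (le ue : 'I_n -> 'I_n -> R) (i : 'I_n) : set (Ty R n) :=
  [set t | lv i <= t.1 <= uv i /\ tnth t.2 i = 0 /\
           forall j, j != i -> le j i <= tnth t.2 j <= ue j i].

Definition ty0 (R : realType) (n : nat) : Ty R n := (0, [tuple 0 | _ < n]).

Definition upd (T : Type) (n : nat) (t : n.-tuple T) (j : 'I_n) (u : T)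
  : n.-tuple T := [tuple (if k == j then u else tnth t k) | k < n].

Fixpoint iexp (R : realType) (n : nat) (F : 'I_n -> probability (Ty R n) R)
  (s : seq 'I_n) (f : n.-tuple (Ty R n) -> \bar R) (t : n.-tuple (Ty R n))
  : \bar R :=
  match s with
  | [::] => f t
  | j :: s' => (\int[F j]_u iexp F s' f (upd t j u))%E
  end.

(* E[ f(t) | t_i = ti ] = expectation over t_{-i} ~ prod_{j<>i} F_j *)
Definition Eothers (R : realType) (n : nat) (F : 'I_n -> probability (Ty R n) R)
  (i : 'I_n) (f : n.-tuple (Ty R n) -> \bar R) (ti : Ty R n) : \bar R :=
  iexp F [seq j <- enum 'I_n | j != i] f [tuple ti | _ < n].

Definition Efull (R : realType) (n : nat) (F : 'I_n -> probability (Ty R n) R)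
  (f : n.-tuple (Ty R n) -> \bar R) : \bar R :=
  iexp F (enum 'I_n) f [tuple ty0 R n | _ < n].

Definition dev (R : realType) (n : nat) (t : n.-tuple (Ty R n)) (i : 'I_n)
  (b : option (Ty R n)) : 'I_n -> option (Ty R n) :=
  fun k => if k == i then b else Some (tnth t k).

Definition truthful (R : realType) (n : nat) (t : n.-tuple (Ty R n))
  : 'I_n -> option (Ty R n) := fun k => Some (tnth t k).

Definition is_mechanism (R : realType) (n : nat)
  (x p : ('I_n -> option (Ty R n)) -> 'I_n -> R) : Prop :=
  forall b i, 0 <= x b i <= 1 /\ (b i = None -> x b i = 0 /\ p b i = 0).

Definition Vint (R : realType) (n : nat) (F : 'I_n -> probability (Ty R n) R)
  (x p : ('I_n -> option (Ty R n)) -> 'I_n -> R) (i : 'I_n)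
  (b : option (Ty R n)) (ti : Ty R n) : \bar R :=
  Eothers F i (fun t =>
    (ti.1 * x (dev t i b) i
     - \sum_(j < n | j != i) tnth (tnth t j).2 i * x (dev t i b) j
     - p (dev t i b) i)%:E) ti.

Definition BNIC (R : realType) (n : nat) (lv uv : 'I_n -> R)
  (le ue : 'I_n -> 'I_n -> R) (F : 'I_n -> probability (Ty R n) R)
  (x p : ('I_n -> option (Ty R n)) -> 'I_n -> R) : Prop :=
  forall i ti th, Tset lv uv le ue i ti -> Tset lv uv le ue i th ->
    (Vint F x p i (Some th) ti <= Vint F x p i (Some ti) ti)%E.

Definition interimIR (R : realType) (n : nat) (lv uv : 'I_n -> R)
  (le ue : 'I_n -> 'I_n -> R) (F : 'I_n -> probability (Ty R n) R)
  (x p : ('I_n -> option (Ty R n)) -> 'I_n -> R) : Prop :=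
  forall i ti, Tset lv uv le ue i ti ->
    (Vint F x p i None ti <= Vint F x p i (Some ti) ti)%E.

Definition ESW (R : realType) (n : nat) (F : 'I_n -> probability (Ty R n) R)
  (x : ('I_n -> option (Ty R n)) -> 'I_n -> R) : \bar R :=
  Efull F (fun t =>
    (\sum_(i < n) ((tnth t i).1 - \sum_(j < n | j != i) tnth (tnth t i).2 j)
                  * x (truthful t) i)%:E).

Definition cond_exp_version (R : realType) (n : nat)
  (P : probability (Ty R n) R) (Y : Ty R n -> R) (h : R -> R) : Prop :=
  measurable_fun setT h /\
  P.-integrable setT (fun t => (h t.1)%:E) /\
  forall A : set R, measurable A ->
    (\int[P]_(t in fst @^-1` A) (Y t)%:E = \int[P]_(t in fst @^-1` A) (h t.1)%:E)%E.

Definition has_density (R : realType) (n : nat) (P : probability (Ty R n) R) : Prop :=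
  exists f : R -> R, (forall r, 0 <= f r) /\ measurable_fun setT f /\
    forall A : set R, measurable A ->
      P (fst @^-1` A) = (\int[lebesgue_measure]_(r in A) (f r)%:E)%E.

Definition ind (R : realType) (b : bool) : R := if b then 1 else 0.

(* g_i(v) = v - sum_{j<>i} E[eta_{j<-i} | v_i = v], with m j i a version of
   E[eta_{j<-i} | v_i = .] *)
Definition gfun (R : realType) (n : nat) (m : 'I_n -> 'I_n -> R -> R)
  (i : 'I_n) (v : R) : R := v - \sum_(j < n | j != i) m j i v.

Definition tau (R : realType) (n : nat) (lv uv : 'I_n -> R)
  (m : 'I_n -> 'I_n -> R -> R) (i : 'I_n) : R :=
  if pselect (exists v, lv i <= v <= uv i /\ 0 <= gfun m i v)
  then inf [set v | lv i <= v <= uv i /\ 0 <= gfun m i v]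
  else uv i.

Definition xM (R : realType) (n : nat) (m : 'I_n -> 'I_n -> R -> R)
  (b : 'I_n -> option (Ty R n)) (j : 'I_n) : R :=
  match b j with
  | None => 0
  | Some tj =>
      match [pick i | b i == None] with
      | None => ind R (0 <= gfun m j tj.1)
      | Some i =>
          if #|[pred k | b k == None]| == 1%N
          then ind R (\sum_(k < n | (k != i) && (k != j)) m k j tj.1 <= tj.1)
          else 0
      end
  end.

Definition extcost (R : realType) (n : nat) (F : 'I_n -> probability (Ty R n) R)
  (m : 'I_n -> 'I_n -> R -> R) (i : 'I_n) : R :=
  \sum_(j < n | j != i)
     fine (\int[F j]_u (tnth u.2 i * ind R (0 <= gfun m j u.1))%:E)%E.

Definition c0 (R : realType) (n : nat) (F : 'I_n -> probability (Ty R n) R)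
  (m : 'I_n -> 'I_n -> R -> R) (i : 'I_n) : R :=
  - \sum_(j < n | j != i)
     fine (\int[F j]_u (tnth u.2 i *
        ind R (\sum_(k < n | (k != i) && (k != j)) m k j u.1 <= u.1))%:E)%E.

(* the payments of the mechanism; on profiles where some bidder abstains the
   paper only fixes p_i = 0 for the abstainer; we set all payments to 0 there *)
Definition pM (R : realType) (n : nat) (lv uv : 'I_n -> R)
  (F : 'I_n -> probability (Ty R n) R) (m : 'I_n -> 'I_n -> R -> R)
  (C : 'I_n -> R) (b : 'I_n -> option (Ty R n)) (i : 'I_n) : R :=
  match [pick k | b k == None] with
  | None => tau lv uv m i * xM m b i - extcost F m i - C i
  | Some _ => 0
  end.

(* Main.v *)
(** Under truthful bidding of the others, a report [th] of bidder [i] enters her utility only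
    through her own allocation and a payment-like term, so the constructed mechanism is a
    posted price [tau i] for the good, and BNIC and interim IR are read off an affine formula
    for the interim utility.  Conversely, BNIC makes the interim allocation [X i] of any
    mechanism monotone in the value.  Hence [X i] depends on the externalities at countably
    many values only, a null set because the value has a density, so in the expected welfare
    [v - sum_j eta_j] can be replaced by its conditional mean [g_i(v)]; the result is largest
    when [X i = 1] exactly on [g_i >= 0]. *)

Require Import Defs.
From HB Require Import structures.
From mathcomp Require Import all_boot all_order all_algebra.
From mathcomp Require Import all_classical all_reals all_analysis.
From mathcomp Require Import measurable_realfun.
From mathcomp Require Import ring lra.

Set Implicit Arguments.
Unset Strict Implicit.
Unset Printing Implicit Defensive.

Import Order.TTheory GRing.Theory Num.Theory.
Local Open Scope classical_set_scope.
Local Open Scope ring_scope.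

(** The externalities in a bidder's own type are those she exerts on others, so they never enter her
    utility; those she suffers belong to independent types. This is why the true type matters only
    through its value, and why incentive constraints compare values only. Two obstacles shape the
    proof. Expectations are iterated extended-real integrals over lists of coordinates, where
    linearity can fail; integrability is therefore carried relative to a base point and survives at
    almost every update of that point only. And conditional means are specified by testing on sets
    of values, whereas interim allocations are weights with values in [0,1]; staircase
    approximations pass from the former to the latter. Nonnegative payments rest on a comparison of
    the externalities bidder [i] suffers when she bids with those she suffers when she abstains: the
    latter are at least as large in expectation, and [c0] is minus their expectation. *)

(** * Iterated expectations: measurability, Tonelli, comparison, linearity *)

Section IteratedExpectation.
Context {R : realType} {n : nat}.
Variable F : 'I_n -> probability (Ty R n) R.
Implicit Types (s : seq 'I_n) (t : n.-tuple (Ty R n)).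

Lemma tnth_upd (T : Type) (t : n.-tuple T) (j k : 'I_n) (u : T) :
  tnth (upd t j u) k = if k == j then u else tnth t k.
Proof. by rewrite /upd tnth_mktuple. Qed.

Lemma updC (T : Type) (t : n.-tuple T) (j k : 'I_n) (u w : T) : j != k ->
  upd (upd t j u) k w = upd (upd t k w) j u.
Proof.
move=> jk; apply: eq_from_tnth => l; rewrite !tnth_upd.
by have [->|//] := eqVneq l k; rewrite eq_sym (negbTE jk).
Qed.

Lemma measurable_upd {d} {T : measurableType d} (j : 'I_n)
    {d'} {S : measurableType d'} (f : S -> n.-tuple T) (g : S -> T) :
  measurable_fun setT f -> measurable_fun setT g ->
  measurable_fun setT (fun z => upd (f z) j (g z)).
Proof.
move=> mf mg; apply/measurable_fun_tnthP => k.
apply: (@eq_measurable_fun _ _ _ _ _ (fun z => if k == j then g z else tnth (f z) k)).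
  by move=> z _ /=; rewrite tnth_upd.
case: (k == j) => //.
exact: (measurableT_comp (measurable_tnth k) mf).
Qed.

Lemma measurable_upd1 (t : n.-tuple (Ty R n)) (j : 'I_n) :
  measurable_fun setT (upd t j : Ty R n -> _).
Proof. exact: (measurable_upd j (measurable_cst t) (@measurable_id _ _ _)). Qed.

Lemma measurable_integral_upd j (f : n.-tuple (Ty R n) -> \bar R) :
  measurable_fun setT f ->
  measurable_fun setT (fun t => \int[F j]_u f (upd t j u))%E.
Proof.
move=> mf; pose g (z : n.-tuple (Ty R n) * Ty R n) := f (upd z.1 j z.2).
have mg : measurable_fun setT g.
  apply: (measurableT_comp mf).
  exact: (measurable_upd j measurable_fst measurable_snd).
rewrite (_ : (fun t => _) = (fun t => \int[F j]_u (g^\+ (t, u)) -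
    \int[F j]_u (g^\- (t, u)))%E); last first.
  apply/funext => t; rewrite [LHS]integralE; congr (_ - _)%E.
    by apply: eq_integral => u _; rewrite !funeposE.
  by apply: eq_integral => u _; rewrite !funenegE.
apply: emeasurable_funB.
- apply: (measurable_fun_fubini_tonelli_F (m2 := F j) (g^\+)%E) => //.
  exact: measurable_funepos.
- apply: (measurable_fun_fubini_tonelli_F (m2 := F j) (g^\-)%E) => //.
  exact: measurable_funeneg.
Qed.

Lemma measurable_iexp s f :
  measurable_fun setT f -> measurable_fun setT (iexp F s f).
Proof. by move=> mf; elim: s => //= j s; exact: measurable_integral_upd. Qed.

Lemma measurable_iexp_upd s f t j :
  measurable_fun setT f -> measurable_fun setT (fun u => iexp F s f (upd t j u)).
Proof.
move=> mf; apply: (measurableT_comp (measurable_iexp s mf)).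
exact: measurable_upd1.
Qed.

Lemma iexp_ge0 s f t : (forall t, 0 <= f t)%E -> (0 <= iexp F s f t)%E.
Proof.
move=> f0; elim: s t => //= j s IH t; exact: integral_ge0.
Qed.

Lemma integral_probability_cst {d} {T : measurableType d} (P : probability T R)
  (r : \bar R) : (\int[P]_u r)%E = r.
Proof.
have := integral_cst P (@measurableT _ T) r => /= ->.
by rewrite [X in (_ * X)%E](probability_setT P) mule1.
Qed.

Lemma iexp_cst s (r : \bar R) t : iexp F s (fun=> r) t = r.
Proof.
elim: s t => //= j s IH t.
under eq_integral do rewrite IH.
exact: integral_probability_cst.
Qed.

(* [iexp] overwrites the coordinates in [s], so the base point matters off [s] only. *)
Lemma eq_iexp_base s f t t' :
  (forall k, k \notin s -> tnth t k = tnth t' k) -> iexp F s f t = iexp F s f t'.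
Proof.
elim: s t t' => [|j s IH] t t' tt' /=.
  by congr f; apply: eq_from_tnth => k; exact: tt'.
apply: eq_integral => u _; apply: IH => k ks; rewrite !tnth_upd.
by case: ifPn => // kj; apply: tt'; rewrite inE negb_or kj.
Qed.

Lemma iexp_coord_notin s j (phi : Ty R n -> \bar R) t : j \notin s ->
  iexp F s (fun t => phi (tnth t j)) t = phi (tnth t j).
Proof.
elim: s t => //= k s IH t; rewrite inE negb_or => /andP[jk js].
under eq_integral => u _ do rewrite IH // tnth_upd (negbTE jk).
exact: integral_probability_cst.
Qed.

Lemma iexp_coord s j (phi : Ty R n -> \bar R) t : j \in s ->
  iexp F s (fun t => phi (tnth t j)) t = (\int[F j]_u phi u)%E.
Proof.
elim: s t => //= k s IH t; rewrite inE.
have [js _|js] := boolP (j \in s).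
  under eq_integral => u _ do rewrite IH //.
  exact: integral_probability_cst.
rewrite orbF => /eqP <-{k}.
by under eq_integral => u _ do rewrite iexp_coord_notin // tnth_upd eqxx.
Qed.

Lemma iexp_scale_coord s j (a : Ty R n -> R) (f : n.-tuple (Ty R n) -> \bar R) t :
  (forall u, 0 <= a u) -> (forall t, 0 <= f t)%E -> measurable_fun setT f ->
  j \notin s ->
  iexp F s (fun t => (a (tnth t j))%:E * f t)%E t = ((a (tnth t j))%:E * iexp F s f t)%E.
Proof.
move=> a0 f0 mf; elim: s t => //= k s IH t; rewrite inE negb_or => /andP[jk js].
under eq_integral => u _ do rewrite IH // tnth_upd (negbTE jk).
apply: ge0_integralZl_EFin => //.
- by move=> u _; exact: iexp_ge0.
- exact: measurable_iexp_upd.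
Qed.

(** Tonelli for two adjacent integrals; nonnegativity replaces integrability. *)
Lemma iexp_swap j i s f t : (forall t, 0 <= f t)%E -> measurable_fun setT f ->
  j != i -> iexp F (j :: i :: s) f t = iexp F (i :: j :: s) f t.
Proof.
move=> f0 mf ji /=.
rewrite (fubini_tonelli (m1 := F j) (m2 := F i)
  (fun z => iexp F s f (upd (upd t j z.1) i z.2))) /=.
- by under eq_integral do under eq_integral do rewrite updC //.
- apply: (measurableT_comp (measurable_iexp s mf)).
  apply: (measurable_upd i _ measurable_snd).
  exact: (measurable_upd j (measurable_cst t) measurable_fst).
- by move=> z; exact: iexp_ge0.
Qed.

Lemma iexp_move_front i s1 s2 f t : (forall t, 0 <= f t)%E ->
  measurable_fun setT f -> i \notin s1 ->
  iexp F (s1 ++ i :: s2) f t = iexp F (i :: s1 ++ s2) f t.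
Proof.
move=> f0 mf; elim: s1 t => // j s1 IH t; rewrite inE negb_or eq_sym => /andP[ij is1].
have -> : iexp F ((j :: s1) ++ i :: s2) f t =
          iexp F (j :: i :: s1 ++ s2) f t.
  by rewrite [LHS]/=; under eq_integral do rewrite IH //.
exact: iexp_swap.
Qed.

Variable A : 'I_n -> set (Ty R n).
Hypothesis FA : forall j, F j (A j) = 1%E.
Hypothesis mA : forall j, measurable (A j).

Definition in_supp t := forall k, A k (tnth t k).

(** The invariant of inductions on [s]: coordinates in [s] are overwritten by draws that lie in [A]
    almost surely, so only the others need to be constrained at the base point. *)
Definition in_supp_off s t := forall k, k \notin s -> A k (tnth t k).

Lemma ae_supp j : \forall u \ae F j, A j u.
Proof.
exists (~` A j); split => //; first exact: measurableC.
by rewrite [LHS]probability_setC // [X in (1 - X)%E]FA subee.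
Qed.

Lemma in_supp_off_upd s t j u :
  in_supp_off (j :: s) t -> A j u -> in_supp_off s (upd t j u).
Proof.
move=> tA Au k ks; rewrite tnth_upd; case: ifPn => [/eqP ->//|kj].
by apply: tA; rewrite inE negb_or kj.
Qed.

Lemma le_iexp s f g t : (forall t, 0 <= f t)%E -> (forall t, 0 <= g t)%E ->
  measurable_fun setT f -> measurable_fun setT g ->
  (forall t, in_supp t -> f t <= g t)%E -> in_supp_off s t ->
  (iexp F s f t <= iexp F s g t)%E.
Proof.
move=> f0 g0 mf mg fg; elim: s t => [|j s IH] t tA /=.
  by apply: fg => k; exact: tA.
apply: ae_ge0_le_integral => //.
- by move=> u _; exact: iexp_ge0.
- exact: measurable_iexp_upd.
- by move=> u _; exact: iexp_ge0.
- exact: measurable_iexp_upd.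
- apply: filterS (ae_supp j) => u Au _; apply: IH.
  exact: in_supp_off_upd.
Qed.

(** Plays the role of integrability for a product measure, but relative to a base point, because one
    integration passes finiteness on to almost every updated base point only. *)
Definition iexp_integrable s (f : n.-tuple (Ty R n) -> R) t :=
  measurable_fun setT f /\ (iexp F s (fun t => `|f t|%:E) t < +oo)%E.

Lemma measurable_norm_EFin {d} {T : measurableType d} (f : T -> R) :
  measurable_fun setT f -> measurable_fun setT (fun x => `|f x|%:E).
Proof. by move=> mf; apply/measurable_EFinP; exact: measurableT_comp. Qed.

Lemma bounded_iexp_integrable s (f : n.-tuple (Ty R n) -> R) t (M : R) : measurable_fun setT f ->
  (forall t, in_supp t -> `|f t| <= M) -> in_supp_off s t ->
  iexp_integrable s f t.
Proof.
move=> mf fM tA; split => //.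
(* The maximum with 0 keeps the dominating constant nonnegative even if [M] is negative. *)
have : (iexp F s (fun t => `|f t|%:E) t <= iexp F s (fun=> (Num.max M 0)%:E) t)%E.
  apply: le_iexp => //.
  - by move=> ?; rewrite lee_fin le_max lexx orbT.
  - exact: measurable_norm_EFin.
  - by move=> t' t'A; rewrite lee_fin le_max fM.
by rewrite iexp_cst => /le_lt_trans; apply; exact: ltry.
Qed.

Lemma ge0_lty_integrable {d} {T : measurableType d} (P : probability T R)
    (f : T -> \bar R) : measurable_fun setT f -> (forall x, 0 <= f x)%E ->
  (\int[P]_x f x < +oo)%E -> P.-integrable setT f.
Proof.
move=> mf f0 foo; apply/integrableP; split => //.
by rewrite (eq_integral f) // => x _; rewrite gee0_abs.
Qed.

Lemma iexp_norm s f t : iexp_integrable s f t ->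
  (`|iexp F s (fun t => (f t)%:E) t| <= iexp F s (fun t => `|f t|%:E) t)%E.
Proof.
move=> [mf]; elim: s t => [|j s IH] t /= foo; first exact: lexx.
apply: (le_trans (le_abse_integral _ _ _)) => //.
  by apply: measurable_iexp_upd; exact/measurable_EFinP.
have mi := measurable_iexp_upd s t j (measurable_norm_EFin mf).
apply: ae_ge0_le_integral => //.
- by apply: measurableT_comp => //; apply: measurable_iexp_upd; exact/measurable_EFinP.
- by move=> u _; exact: iexp_ge0.
(* A finite outer integral makes the inner one finite for almost every [u], and there the induction
   hypothesis applies. *)
- have /integrable_ae : (F j).-integrable setT
      (fun u => iexp F s (fun t => `|f t|%:E) (upd t j u)).
    by apply: ge0_lty_integrable => // u; exact: iexp_ge0.
  move=> /(_ measurableT); apply: filterS => u /(_ I) fu _.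
  by apply: IH; rewrite ltey_eq fu.
Qed.

Lemma iexp_fin_num s f t : iexp_integrable s f t ->
  iexp F s (fun t => (f t)%:E) t \is a fin_num.
Proof.
move=> fi; rewrite fin_num_abs (le_lt_trans (iexp_norm fi)) //.
by case: fi.
Qed.

(** By [iexp_norm] the inner iterated integrals are dominated by those of the absolute values, hence
    integrable, so each layer is linear. The induction hypothesis holds for almost every draw, which
    is enough under the integral. *)
Lemma iexp_linear s c f g t : iexp_integrable s f t -> iexp_integrable s g t ->
  iexp F s (fun t => (c * f t + g t)%:E) t =
  (c%:E * iexp F s (fun t => (f t)%:E) t + iexp F s (fun t => (g t)%:E) t)%E.
Proof.
move=> [mf +] [mg +].
elim: s t => [|j s IH] t //= foo goo.
have [mF mG] : measurable_fun setT (fun t => (f t)%:E) /\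
  measurable_fun setT (fun t => (g t)%:E) by split; exact/measurable_EFinP.
have aux (h : n.-tuple (Ty R n) -> R) : measurable_fun setT h ->
  (\int[F j]_u iexp F s (fun t => `|h t|%:E) (upd t j u) < +oo)%E ->
  (F j).-integrable setT (fun u => iexp F s (fun t => `|h t|%:E) (upd t j u)).
  move=> mh; apply: ge0_lty_integrable.
    by apply: measurable_iexp_upd; exact: measurable_norm_EFin.
  by move=> u; exact: iexp_ge0.
have aux2 (h : n.-tuple (Ty R n) -> R) : measurable_fun setT h ->
  (\int[F j]_u iexp F s (fun t => `|h t|%:E) (upd t j u) < +oo)%E ->
  (F j).-integrable setT (fun u => iexp F s (fun t => (h t)%:E) (upd t j u)).
  move=> mh hoo; apply/integrableP; split.
    by apply: measurable_iexp_upd; exact/measurable_EFinP.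
  apply: (le_lt_trans _ (hoo)); apply: ae_ge0_le_integral => //.
  - by apply: measurableT_comp => //; apply: measurable_iexp_upd; exact/measurable_EFinP.
  - by move=> u _; exact: iexp_ge0.
  - by apply: measurable_iexp_upd; exact: measurable_norm_EFin.
  - have /integrable_ae := aux h mh hoo.
    move=> /(_ measurableT); apply: filterS => u /(_ I) fu _.
    by apply: iexp_norm; split => //; rewrite ltey_eq fu.
rewrite -integralZl ?aux2 // -integralD //; last 2 first.
- by apply: integrableZl => //; exact: aux2.
- exact: aux2.
apply: ae_eq_integral => //.
- apply: measurable_iexp_upd; apply/measurable_EFinP.
  by apply: measurable_funD => //; exact: measurable_funM.
- apply: emeasurable_funD; last exact: measurable_iexp_upd.
  by apply: measurable_funeM; exact: measurable_iexp_upd.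
- have := integrable_ae measurableT (aux f mf foo).
  have := integrable_ae measurableT (aux g mg goo).
  apply: filterS2 => u /(_ I) gu /(_ I) fu _.
  by apply: IH; rewrite ltey_eq ?fu ?gu.
Qed.

End IteratedExpectation.

(** * Finite sums, and expectations conditional on one bidder's type *)

Section IteratedSums.
Context {R : realType} {n : nat}.
Variable F : 'I_n -> probability (Ty R n) R.
Implicit Types (s : seq 'I_n) (t : n.-tuple (Ty R n)).

Lemma iexp_integrable_linear s c (f g : n.-tuple (Ty R n) -> R) t :
  iexp_integrable F s f t -> iexp_integrable F s g t ->
  iexp_integrable F s (fun t => c * f t + g t) t.
Proof.
move=> [mf foo] [mg goo].
have nrm (h : n.-tuple (Ty R n) -> R) : measurable_fun setT h ->
    (iexp F s (fun t => `|h t|%:E) t < +oo)%E ->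
    iexp_integrable F s (fun t => `|h t|) t.
  move=> mh hoo; split; first exact: measurableT_comp.
  by under [X in iexp F s X]eq_fun do rewrite normr_id.
have mcfg : measurable_fun setT (fun t => c * f t + g t).
  by apply: measurable_funD => //; exact: measurable_funM.
have mncfg : measurable_fun setT (fun t => `|c| * `|f t| + `|g t|).
  apply: measurable_funD; last exact: measurableT_comp.
  by apply: measurable_funM => //; exact: measurableT_comp.
split => //.
(* The triangle inequality reduces the claim to absolute values, for which [iexp_linear] is already
   available. *)
apply: (@le_lt_trans _ _ (iexp F s (fun t => (`|c| * `|f t| + `|g t|)%:E) t)).
  apply: (@le_iexp _ _ F (fun=> setT)) => //.
  - by move=> j; exact: probability_setT.
  - exact: measurable_norm_EFin.
  - exact/measurable_EFinP.
  - by move=> t' _; rewrite lee_fin -normrM ler_normD.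
have [fi gi] := (nrm f mf foo, nrm g mg goo).
rewrite iexp_linear //.
have /fin_numPlt/andP[_ H1] := iexp_fin_num fi.
have /fin_numPlt/andP[_ H2] := iexp_fin_num gi.
by rewrite lte_add_pinfty // lte_mul_pinfty.
Qed.

Lemma iexp_integrable_cst s (c : R) t : iexp_integrable F s (fun=> c) t.
Proof. by split => //; rewrite iexp_cst ltry. Qed.

Lemma iexp_integrable_sum s (I : Type) (r : seq I) (P : pred I)
    (f : I -> n.-tuple (Ty R n) -> R) t :
  (forall i, P i -> iexp_integrable F s (f i) t) ->
  iexp_integrable F s (fun t => \sum_(i <- r | P i) f i t) t.
Proof.
move=> fi; elim: r => [|a r IH].
  under eq_fun do rewrite big_nil; exact: iexp_integrable_cst.
under eq_fun do rewrite big_cons.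
have [Pa|//] := boolP (P a).
under eq_fun do rewrite -[f a _]mul1r.
by apply: iexp_integrable_linear => //; exact: fi.
Qed.

Lemma iexp_sum s (I : Type) (r : seq I) (P : pred I)
    (f : I -> n.-tuple (Ty R n) -> R) t :
  (forall i, P i -> iexp_integrable F s (f i) t) ->
  iexp F s (fun t => (\sum_(i <- r | P i) f i t)%:E) t =
  (\sum_(i <- r | P i) iexp F s (fun t => (f i t)%:E) t)%E.
Proof.
move=> fi; elim: r => [|a r IH].
  by under eq_fun do rewrite big_nil; rewrite iexp_cst big_nil.
under eq_fun do rewrite big_cons.
rewrite big_cons; have [Pa|//] := boolP (P a).
under eq_fun do rewrite -[f a _]mul1r.
rewrite iexp_linear; last exact: iexp_integrable_sum.
  by rewrite mul1e IH.
exact: fi.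
Qed.

Lemma iexp_upd_notin s i f th t : i \notin s ->
  iexp F s (fun t => f (upd t i th)) t = iexp F s f (upd t i th).
Proof.
elim: s t => //= j s IH t; rewrite inE negb_or => /andP[ij is1].
by apply: eq_integral => u _; rewrite IH // updC // eq_sym.
Qed.

Definition others (i : 'I_n) := [seq j <- enum 'I_n | j != i].

Lemma mem_others i j : (j \in others i) = (j != i).
Proof. by rewrite mem_filter mem_enum andbT. Qed.

(** A misreport is a change of base point: by independence, what [th] induces against truthful
    opponents does not depend on the true type [ti]. *)
Lemma Eothers_upd i f th ti :
  Eothers F i (fun t => f (upd t i th)) ti = Eothers F i f th.
Proof.
rewrite /Eothers -/(others i) iexp_upd_notin ?mem_others ?eqxx //.
apply: eq_iexp_base => k.
by rewrite mem_others negbK => /eqP ->; rewrite tnth_upd eqxx tnth_mktuple.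
Qed.

(** Conditioning on bidder [i]: Tonelli moves her integral outermost, and what remains is the
    interim expectation. *)
Lemma Efull_first i (f : n.-tuple (Ty R n) -> \bar R) :
  (forall t, 0 <= f t)%E -> measurable_fun setT f ->
  Efull F f = (\int[F i]_u Eothers F i f u)%E.
Proof.
move=> f0 mf; rewrite /Efull.
have : i \in enum 'I_n by rewrite mem_enum.
case/splitPr E : _ / => [s1 s2].
have : uniq (enum 'I_n) by exact: enum_uniq.
rewrite E cat_uniq /= => /and3P[_ /norP[is1 _] /andP[is2 _]].
rewrite iexp_move_front //=; apply: eq_integral => u _.
have fid s : i \notin s -> [seq j <- s | j != i] = s.
  move=> ins; apply/all_filterP/allP => j js.
  by apply: contraNneq ins => <-.
have eo : others i = s1 ++ s2 by rewrite /others E filter_cat /= eqxx !fid.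
rewrite /Eothers -/(others i) -eo; apply: eq_iexp_base => k.
by rewrite mem_others negbK => /eqP ->; rewrite tnth_upd eqxx tnth_mktuple.
Qed.

Lemma Efull_mul_coord i (a : Ty R n -> R) (f : n.-tuple (Ty R n) -> \bar R) :
  (forall u, 0 <= a u) -> measurable_fun setT a ->
  (forall t, 0 <= f t)%E -> measurable_fun setT f ->
  Efull F (fun t => (a (tnth t i))%:E * f t)%E =
  (\int[F i]_u ((a u)%:E * Eothers F i f u))%E.
Proof.
move=> a0 ma f0 mf; rewrite (Efull_first i).
- apply: eq_integral => u _; rewrite [LHS]iexp_scale_coord ?tnth_mktuple //.
  by rewrite -/(others i) mem_others eqxx.
- by move=> t; rewrite mule_ge0 // lee_fin.
- apply: emeasurable_funM => //; apply/measurable_EFinP.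
  exact: (measurableT_comp ma (measurable_tnth i)).
Qed.

Lemma measurable_Eothers i (f : n.-tuple (Ty R n) -> \bar R) :
  measurable_fun setT f -> measurable_fun setT (Eothers F i f).
Proof.
move=> mf.
(* [Eothers] places [u] in every coordinate, but only coordinate [i] survives; a fixed base point
   updated at [i] makes the dependence on [u] measurable. *)
have -> : Eothers F i f = fun u => iexp F (others i) f (upd [tuple ty0 R n | _ < n] i u).
  apply/funext => u; apply: eq_iexp_base => k; rewrite mem_others negbK => /eqP ->.
  by rewrite tnth_upd eqxx tnth_mktuple.
exact: measurable_iexp_upd.
Qed.

End IteratedSums.

(** * From test sets to bounded weights by staircase approximation *)

Section ConditionalExpectation.
Context {R : realType}.

(** The sum counts the integers from 1 to [k] that are at most [y], so it is the integer part of
    [y]. *)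
Lemma staircase_bound (k : nat) (y : R) : 0 <= y <= k%:R ->
  y - 1 <= \sum_(l < k) (l.+1%:R <= y)%R%:R <= y.
Proof.
elim: k => [|k IH] /andP[y0 yk].
  have /eqP -> : y == 0 by rewrite eq_le yk y0.
  by rewrite big_ord0 lexx sub0r oppr_le0 ler01.
rewrite big_ord_recr /=; have [yk'|ky] := leP y k%:R.
  have -> : (k.+1%:R <= y) = false.
    by apply/negbTE; rewrite -ltNge (le_lt_trans yk') // ltr_nat.
  by rewrite addr0; apply: IH; rewrite y0.
have -> : \sum_(l < k) (l.+1%:R <= y)%R%:R = k%:R :> R.
  rewrite (eq_bigr (fun=> 1)) ?sumr_const ?card_ord // => l _.
  by rewrite (le_trans _ (ltW ky)) // ler_nat.
case: (leP k.+1%:R y) => [ky1|yk1].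
  by rewrite natr1 ky1 andbT lerBlDr (le_trans yk) // lerDl.
by rewrite addr0 (ltW ky) andbT lerBlDr natr1 ltW.
Qed.

Lemma staircase_approx (k : nat) (c : R) : 0 <= c <= 1 ->
  `|c - \sum_(l < k.+1) k.+1%:R^-1 * (l.+1%:R <= k.+1%:R * c)%R%:R| <= k.+1%:R^-1.
Proof.
move=> /andP[c0 c1]; rewrite -mulr_sumr; set S := \sum_(_ < _) _.
have k0 : 0 < k.+1%:R :> R by [].
have : k.+1%:R * c - 1 <= S <= k.+1%:R * c.
  by apply: staircase_bound; rewrite mulr_ge0 //= ler_piMr.
have -> : c - k.+1%:R^-1 * S = k.+1%:R^-1 * (k.+1%:R * c - S).
  by rewrite mulrBr mulKf // lt0r_neq0.
rewrite normrM gtr0_norm ?invr_gt0 //.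
move=> /andP[S1 S2]; rewrite ler_piMr ?invr_ge0 // ger0_norm ?subr_ge0 //.
by rewrite lerBlDr addrC -lerBlDr.
Qed.

Context {d : measure_display} {T : measurableType d}.
Variable P : probability T R.

Lemma integrable_mul_bounded (Z b : T -> R) (M : R) :
  measurable_fun setT b -> (forall u, `|b u| <= M) ->
  P.-integrable setT (EFin \o Z) -> P.-integrable setT (fun u => (Z u * b u)%:E).
Proof.
move=> mb bM iZ.
have mZ : measurable_fun setT Z by apply/measurable_EFinP; exact: (measurable_int _ iZ).
apply: (@le_integrable _ _ _ P _ measurableT _ (fun u => M%:E * (Z u)%:E)%E).
- by apply/measurable_EFinP; exact: measurable_funM.
- move=> u _; rewrite -EFinM !abse_EFin lee_fin !normrM mulrC ler_wpM2r //.
  by rewrite (le_trans (bM u)) // ler_norm.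
- exact: integrableZl.
Qed.

(* [chi] is a uniform limit of staircases, on whose steps the last hypothesis applies. *)
Lemma integral_mul_eq0 (Z V : T -> R) (chi : R -> R) :
  P.-integrable setT (EFin \o Z) ->
  measurable_fun setT V -> measurable_fun setT chi ->
  (forall v, 0 <= chi v <= 1) ->
  (forall A : set R, measurable A -> (\int[P]_(u in V @^-1` A) (Z u)%:E = 0)%E) ->
  (\int[P]_u (Z u * chi (V u))%:E = 0)%E.
Proof.
move=> iZ mV mchi chi01 Z0.
have mcV : measurable_fun setT (chi \o V) by exact: measurableT_comp.
have chiM u : `|chi (V u)| <= 1.
  by have /andP[c0 c1] := chi01 (V u); rewrite ger0_norm.
have mZ : measurable_fun setT Z by apply/measurable_EFinP; exact: (measurable_int _ iZ).
have mnZ : measurable_fun setT (fun u => `|(Z u)%:E|)%E.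
  by apply: measurableT_comp => //; exact/measurable_EFinP.
have iZchi := integrable_mul_bounded mcV chiM iZ.
pose I := (\int[P]_u (Z u * chi (V u))%:E)%E.
have finI : I \is a fin_num by exact: integrable_fin_num.
pose K := fine (\int[P]_u `|(Z u)%:E|)%E.
have finK : (\int[P]_u `|(Z u)%:E|)%E = K%:E.
  rewrite fineK //; apply: integrable_fin_num => //.
  exact: integrable_abse.
have mstep (k l : nat) :
    measurable_fun setT (fun u => (l.+1%:R <= k.+1%:R * chi (V u))%R%:R : R).
  apply: (eq_measurable_fun (fun u => if l.+1%:R <= k.+1%:R * chi (V u) then 1 else 0 : R)).
    by move=> u _; case: ifP.
  apply: measurable_fun_ifT => //; apply: measurable_fun_ler => //.
  exact: measurable_funM.
have istep (k l : nat) : P.-integrable setT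
    (fun u => (Z u * (l.+1%:R <= k.+1%:R * chi (V u))%R%:R)%:E).
  apply: (@integrable_mul_bounded _ _ 1) => // u.
  by rewrite ger0_norm ?ler0n // lern1 leq_b1.
have step0 (k l : nat) :
    (\int[P]_u (Z u * (l.+1%:R <= k.+1%:R * chi (V u))%R%:R)%:E = 0)%E.
  (* Each step is the indicator of a superlevel set of [chi], which is a set of values and so an
     admissible test set. *)
  rewrite -(Z0 [set v | l.+1%:R <= k.+1%:R * chi v]).
    rewrite [RHS]integral_mkcond; apply: eq_integral => u _.
    rewrite patchE; case: ifPn => [|]; rewrite ?inE ?notin_setE /= => H.
      by rewrite H mulr1.
    by move/negP/negbTE: H => ->; rewrite mulr0.
  rewrite -[X in measurable X]setTI.
  by apply: measurable_fun_le => //; exact: measurable_funM.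
(* Subtracting the staircase [q] leaves the integral unchanged, and [chi - q] is at most 1/(k+1) in
   absolute value; [K] is the mean of the absolute value of [Z]. *)
have bound (k : nat) : `|fine I| <= K / k.+1%:R.
  pose q u := \sum_(l < k.+1) k.+1%:R^-1 * (l.+1%:R <= k.+1%:R * chi (V u))%R%:R : R.
  have mq : measurable_fun setT q.
    by apply: measurable_sum => l; apply: measurable_funM.
  have qE u : ((Z u * q u)%:E = \sum_(l < k.+1) (k.+1%:R^-1)%:E *
     (Z u * (l.+1%:R <= k.+1%:R * chi (V u))%R%:R)%:E)%E.
    rewrite /q mulr_sumr -sumEFin; apply: eq_bigr => l _.
    by rewrite -EFinM mulrCA.
  have iq : P.-integrable setT (fun u => (Z u * q u)%:E).
    under eq_fun do rewrite qE.
    by apply: integrable_sum => // l _; exact: integrableZl.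
  have q0 : (\int[P]_u (Z u * q u)%:E = 0)%E.
    under eq_integral do rewrite qE.
    rewrite integral_sum //; last by move=> l; exact: integrableZl.
    by rewrite big1 // => l _; rewrite integralZl // step0 mule0.
  have IE : I = (\int[P]_u (Z u * (chi (V u) - q u))%:E)%E.
    transitivity (I - \int[P]_u (Z u * q u)%:E)%E; first by rewrite q0 sube0.
    rewrite /I -integralB_EFin //.
    by apply: eq_integral => u _; rewrite -EFinB mulrBr.
  rewrite -lee_fin -abse_EFin fineK // IE.
  apply: (le_trans (le_abse_integral _ _ _)) => //.
    apply/measurable_EFinP; apply: measurable_funM => //.
    exact: measurable_funB.
  rewrite EFinM muleC -finK -ge0_integralZl_EFin //.
  apply: ge0_le_integral => //.
  - apply: measurableT_comp => //; apply/measurable_EFinP; apply: measurable_funM => //.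
    exact: measurable_funB.
  - exact: measurable_funeM.
  - move=> u _; rewrite abse_EFin -EFinM lee_fin normrM mulrC ler_wpM2r //.
    exact: staircase_approx.
rewrite -/I -(fineK finI); congr EFin; apply/eqP; rewrite -normr_le0.
apply/ler_addgt0Pr => e e0; rewrite add0r.
have K0 : 0 <= K by rewrite -lee_fin -finK; exact: integral_ge0.
have [K1|K1] := eqVneq K 0.
  by have := bound 0%N; rewrite K1 mul0r => /le_trans; apply; exact: ltW.
have {K1}K0 : 0 < K by rewrite lt_neqAle eq_sym K1.
have [k Hk] : exists k : nat, K / e < k.+1%:R.
  exists (Num.truncn (K / e)); exact: truncnS_gt.
apply: (le_trans (bound k)); rewrite ler_pdivrMr // mulrC -ler_pdivrMr //.
exact: ltW.
Qed.

(* Integrability and measurability of bounded integrands *)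
End ConditionalExpectation.

Section BoundedIntegrable.
Context {R : realType} {d : measure_display} {T : measurableType d}.

Lemma bounded_ae_integrable (P : probability T R) (A : set T) (f : T -> R) (M : R) :
  measurable A -> P A = 1%E -> measurable_fun setT f ->
  (forall u, A u -> `|f u| <= M) -> P.-integrable setT (EFin \o f).
Proof.
move=> mA PA mf fM; apply/integrableP; split; first exact/measurable_EFinP.
have : (\int[P]_u `|(EFin \o f) u| <= (Num.max M 0)%:E * P setT)%E.
  apply: integral_le_bound => //; first exact/measurable_EFinP.
    by rewrite lee_fin le_max lexx orbT.
  exists (~` A); split; first exact: measurableC.
    by rewrite [LHS]probability_setC // [X in (1 - X)%E]PA subee.
  move=> u /=; apply: contra_not => /fM uM _.
  by rewrite lee_fin le_max uM.
move=> /le_lt_trans; apply.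
by rewrite [X in (_ * X)%E](probability_setT P) mule1 ltry.
Qed.

Lemma measurable_ind (b : T -> bool) : measurable_fun setT b ->
  measurable_fun setT (fun u => ind R (b u)).
Proof. by move=> mb; exact: measurable_fun_ifT. Qed.

Lemma measurable_sum_cond (I : Type) (r : seq I) (Q : pred I) (h : I -> T -> R) :
  (forall i, Q i -> measurable_fun setT (h i)) ->
  measurable_fun setT (fun u => \sum_(i <- r | Q i) h i u).
Proof.
move=> mh; under eq_fun do rewrite big_mkcond.
apply: measurable_sum => i.
by have [Qi|_] := boolP (Q i); [exact: mh|exact: measurable_cst].
Qed.

End BoundedIntegrable.

Lemma ind_01 (R : realType) b : 0 <= ind R b <= 1.
Proof. by case: b; rewrite /ind ?ler01 lexx. Qed.

Lemma ind_ge0 (R : realType) b : 0 <= ind R b.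
Proof. by have /andP[] := ind_01 R b. Qed.

(** * Conditional expectation given the value *)

Section IsCondExp.
Context {R : realType} {n : nat}.
Variable P : probability (Ty R n) R.
Implicit Types (Y : Ty R n -> R) (h : R -> R).

(** [cond_exp_version] requires integrability of [h] only; adding that of [Y] makes the notion
    stable under linear combinations. *)
Definition is_cond_exp Y h :=
  P.-integrable setT (EFin \o Y) /\ cond_exp_version P Y h.

Lemma measurable_preimage_fst (A : set R) : measurable A ->
  measurable (fst @^-1` A : set (Ty R n)).
Proof.
move=> mA; rewrite -[X in measurable X]setTI.
exact: (@measurable_fst _ _ R (n.-tuple R)).
Qed.

Lemma is_cond_exp_linear c Y1 Y2 h1 h2 :
  is_cond_exp Y1 h1 -> is_cond_exp Y2 h2 ->
  is_cond_exp (fun u => c * Y1 u + Y2 u) (fun v => c * h1 v + h2 v).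
Proof.
move=> [iY1 [mh1 [ih1 E1]]] [iY2 [mh2 [ih2 E2]]].
have int2 (f g : Ty R n -> R) D : measurable D ->
    P.-integrable D (EFin \o f) -> P.-integrable D (EFin \o g) ->
    P.-integrable D (fun u => (c * f u + g u)%:E).
  move=> mD fi gi.
  apply: (@eq_integrable _ _ _ P D mD (fun u => c%:E * (f u)%:E + (g u)%:E)%E) => //.
  by apply: integrableD => //; exact: integrableZl.
have E (f g : Ty R n -> R) D : measurable D ->
    P.-integrable D (EFin \o f) -> P.-integrable D (EFin \o g) ->
    (\int[P]_(u in D) (c * f u + g u)%:E =
     c%:E * (\int[P]_(u in D) (f u)%:E) + \int[P]_(u in D) (g u)%:E)%E.
  move=> mD fi gi; rewrite -integralZl // -integralD //.
  exact: integrableZl.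
split; first exact: int2.
split; first by apply: measurable_funD => //; exact: measurable_funM.
split; first exact: (int2 (h1 \o fst) (h2 \o fst)).
move=> A mA; have mD := measurable_preimage_fst mA.
have res (f : Ty R n -> R) : P.-integrable setT (EFin \o f) ->
    P.-integrable (fst @^-1` A) (EFin \o f).
  exact: integrableS.
rewrite E; [|by []|exact: res|exact: res].
rewrite (E (h1 \o fst) (h2 \o fst)); [|by []|exact: (res (h1 \o fst))|exact: (res (h2 \o fst))].
by rewrite E1 // E2.
Qed.

Lemma is_cond_exp_cst (c : R) : is_cond_exp (fun=> c) (fun=> c).
Proof.
have ic : P.-integrable setT (fun=> c%:E) by exact: finite_measure_integrable_cst.
by split => //; split.
Qed.

Lemma is_cond_exp_sum (I : Type) (r : seq I) (Q : pred I) (Y : I -> Ty R n -> R)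
    (h : I -> R -> R) : (forall i, Q i -> is_cond_exp (Y i) (h i)) ->
  is_cond_exp (fun u => \sum_(i <- r | Q i) Y i u) (fun v => \sum_(i <- r | Q i) h i v).
Proof.
move=> Yh; elim: r => [|a r IH].
  under eq_fun do rewrite big_nil; under [X in is_cond_exp _ X]eq_fun do rewrite big_nil.
  exact: is_cond_exp_cst.
under eq_fun do rewrite big_cons; under [X in is_cond_exp _ X]eq_fun do rewrite big_cons.
have [Qa|//] := boolP (Q a).
under eq_fun do rewrite -[Y a _]mul1r.
under [X in is_cond_exp _ X]eq_fun do rewrite -[h a _]mul1r.
by apply: is_cond_exp_linear => //; exact: Yh.
Qed.

(** The difference of [Y] and [h] integrates to 0 over every set of values, so [integral_mul_eq0]
    applies to it. *)
Lemma is_cond_exp_mul Y h (chi : R -> R) : is_cond_exp Y h ->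
  measurable_fun setT chi -> (forall v, 0 <= chi v <= 1) ->
  (\int[P]_u (Y u * chi u.1)%:E = \int[P]_u (h u.1 * chi u.1)%:E)%E.
Proof.
move=> [iY [mh [ih E]]] mchi chi01.
have mcf : measurable_fun setT (fun u : Ty R n => chi u.1).
  exact: (measurableT_comp mchi measurable_fst).
have chiM (u : Ty R n) : `|chi u.1| <= 1.
  by have /andP[c0 c1] := chi01 u.1; rewrite ger0_norm.
have iYc := integrable_mul_bounded mcf chiM iY.
have ihc := integrable_mul_bounded (Z := fun u => h u.1) mcf chiM ih.
have iZ : P.-integrable setT (EFin \o (fun u => Y u - h u.1)).
  exact: (integrableB measurableT iY ih).
have := @integral_mul_eq0 _ _ _ P (fun u => Y u - h u.1) fst chi iZ measurable_fst mchi chi01.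
have H (A : set R) : measurable A ->
    (\int[P]_(u in fst @^-1` A) (Y u - h u.1)%:E = 0)%E.
  move=> mA; have mD := measurable_preimage_fst mA.
  have res (f : Ty R n -> R) : P.-integrable setT (EFin \o f) ->
      P.-integrable (fst @^-1` A) (EFin \o f).
    exact: integrableS.
  under eq_integral do rewrite EFinB.
  rewrite integralB_EFin //; [|exact: res|exact: (res (fun u => h u.1))].
  rewrite E // subee //; apply: integrable_fin_num => //.
  exact: (res (fun u => h u.1)).
move=> /(_ H).
under eq_integral do rewrite mulrBl EFinB.
rewrite integralB_EFin //.
rewrite -(fineK (integrable_fin_num measurableT iYc)).
rewrite -(fineK (integrable_fin_num measurableT ihc)) -EFinB => /eqP.
by rewrite eqe subr_eq0 => /eqP ->.
Qed.

(** On the set where [h] is negative, its integral equals that of [Y] and so is nonnegative; hence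
    [h] vanishes almost everywhere on that set, which must be null. *)
Lemma is_cond_exp_ge0 Y h : is_cond_exp Y h -> (\forall u \ae P, 0 <= Y u) ->
  \forall u \ae P, 0 <= h u.1.
Proof.
move=> [iY [mh [ih E]]] Y0.
pose A := [set v : R | h v < 0].
have mA : measurable A.
  have -> : A = ~` (setT `&` [set v | 0 <= h v]).
    rewrite /A; apply/seteqP; split => v /=; first by rewrite ltNge => /negP nh [_].
    by move=> nh; rewrite ltNge; apply/negP => hv; apply: nh.
  by apply: measurableC; exact: measurable_fun_le.
have mD := measurable_preimage_fst mA.
have mY : measurable_fun setT (EFin \o Y) by exact: (measurable_int _ iY).
have mhf : measurable_fun setT (fun u : Ty R n => (h u.1)%:E).
  exact: (measurable_int _ ih).
have h0 : (0 <= \int[P]_(u in fst @^-1` A) (h u.1)%:E)%E.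
  rewrite -E // (ae_eq_integral (fun u => `|(Y u)%:E|)%E) //.
  - exact: integral_ge0.
  - exact: measurable_funTS.
  - by apply: measurableT_comp => //; exact: measurable_funTS.
  - by apply: filterS Y0 => u Yu _; rewrite /= ger0_norm.
have : (\int[P]_(u in fst @^-1` A) `|(h u.1)%:E| = 0)%E.
  apply/eqP; rewrite eq_le integral_ge0 // andbT.
  rewrite -leeN2 oppe0 -integral_ge0N //.
  rewrite (eq_integral (fun u => (h u.1)%:E)) // => u; rewrite inE /= => hu.
  by rewrite ltr0_norm // opprK.
move/(ae_eq_integral_abs _ mD (measurable_funTS mhf)).
apply: filterS => u; rewrite leNgt => /= hu; apply/negP => hu0.
by have [] := hu hu0; move/eqP; rewrite lt_eqF.
Qed.

Lemma density_null (D : set R) : has_density P -> countable D ->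
  P (fst @^-1` D) = 0%E.
Proof.
move=> [f [f0 [mf E]]] cD.
have mD : measurable D by apply: countable_measurable.
rewrite E //; apply: null_set_integral => //; last exact: countable_lebesgue_measure0.
by apply: measurable_funTS; exact/measurable_EFinP.
Qed.

End IsCondExp.

(* A rational strictly inside each gap identifies it, since gaps at different values are disjoint. *)
Lemma countable_gaps (R : realType) (S : Type) (V X : S -> R) (A : set S) :
  (forall s s', A s -> A s' -> V s < V s' -> X s <= X s') ->
  countable [set v | exists s s', [/\ A s, A s', V s = v, V s' = v & X s < X s']].
Proof.
move=> mono; set D := [set v | _].
have choose v : exists q : rat, D v -> exists s s',
    [/\ A s, A s', V s = v & V s' = v] /\ X s < ratr q < X s'.
  have [[s [s' [As As' Vs Vs' ss']]]|nD] := pselect (D v); last by exists 0.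
  have [q] := rat_in_itvoo ss'; rewrite in_itv /= => qss'.
  by exists q => _; exists s, s'.
have [q qP] := boolp.choice choose.
have lt_q v v' : D v -> D v' -> v < v' -> q v < q v'.
  move=> /qP[s [s' [[As As' Vs Vs'] /andP[_ q1]]]].
  move=> /qP[r [r' [[Ar Ar' Vr Vr'] /andP[q2 _]]]] vv'.
  rewrite -(ltr_rat R); apply: (lt_trans q1); apply: le_lt_trans q2.
  by apply: mono => //; rewrite Vs' Vr.
apply: (@sub_countable _ _ D [set: rat]); last exact: countableP.
apply/pcard_injP; exists q => v v'; rewrite !inE => Dv Dv' qvv'.
by case: (ltgtP v v') => // [/(lt_q _ _ Dv Dv')|/(lt_q _ _ Dv' Dv)]; rewrite qvv' ltxx.
Qed.

(** * The market: bounds on types, conditional social value, threshold price *)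

Section Market.
Context {R : realType} {n : nat}.
Variables (lv uv : 'I_n -> R) (le ue : 'I_n -> 'I_n -> R).
Variables (F : 'I_n -> probability (Ty R n) R) (m : 'I_n -> 'I_n -> R -> R).
Hypothesis lvuv : forall i, 0 <= lv i <= uv i.
Hypothesis leue : forall i j, j != i -> 0 <= le j i <= ue j i.
Hypothesis FT : forall i, F i (Tset lv uv le ue i) = 1%E.
Hypothesis Fm : forall i j, j != i ->
  cond_exp_version (F i) (fun t => tnth t.2 j) (m j i).
Hypothesis gmono : forall i a b, lv i <= a -> a <= b -> b <= uv i ->
  gfun m i a <= gfun m i b.

Local Notation T := (Tset lv uv le ue).
Local Notation win i v := (ind R (0 <= gfun m i v)).
Local Notation win_without i j v :=
  (ind R (\sum_(k < n | (k != i) && (k != j)) m k j v <= v)).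

Lemma measurable_ext (k : 'I_n) : measurable_fun setT (fun u : Ty R n => tnth u.2 k).
Proof. exact: (measurableT_comp (measurable_tnth k) measurable_snd). Qed.

Lemma measurable_Tset i : measurable (T i).
Proof.
have -> : T i = (setT `&` fst @^-1` `[lv i, uv i]) `&`
   ((setT `&` (fun u : Ty R n => tnth u.2 i) @^-1` [set 0]) `&`
    \bigcap_(j in [set j | j != i])
      (setT `&` (fun u : Ty R n => tnth u.2 j) @^-1` `[le j i, ue j i])).
  apply/seteqP; split => u /=.
    move=> [uv1 [u0 uj]]; split; first by rewrite /= in_itv.
    by split => // j /= /uj ?; rewrite in_itv.
  rewrite in_itv /= => -[[_ uv1] [[_ u0] uj]]; split => //; split => // j ji.
  by have [_] := uj j ji; rewrite /= in_itv.
apply: measurableI.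
  exact: (@measurable_fst _ _ R (n.-tuple R)).
apply: measurableI; first exact: measurable_ext.
apply: fin_bigcap_measurable => [|j _]; first exact: finite_finset.
exact: measurable_ext.
Qed.
Local Hint Resolve measurable_Tset : core.

Lemma ext_bound i j u : j != i -> T i u -> 0 <= tnth u.2 j <= ue j i.
Proof.
move=> ji [_ [_ /(_ _ ji)/andP[lu uu]]]; have /andP[l0 _] := leue ji.
by rewrite uu andbT (le_trans l0).
Qed.

Lemma ext_norm i j u : j != i -> T i u -> `|tnth u.2 j| <= ue j i.
Proof. by move=> ji /(ext_bound ji)/andP[e0 eu]; rewrite ger0_norm. Qed.

Lemma value_norm i u : T i u -> `|u.1| <= uv i.
Proof.
move=> [/andP[lu uu] _]; rewrite ger0_norm //.
by have /andP[l0 _] := lvuv i; exact: le_trans lu.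
Qed.

Lemma is_cond_exp_ext i j : j != i ->
  is_cond_exp (F i) (fun u => tnth u.2 j) (m j i).
Proof.
move=> ji; split; last exact: Fm.
apply: (bounded_ae_integrable (measurable_Tset i)) => //; first exact: measurable_ext.
by move=> u; exact: ext_norm.
Qed.

(** The coefficient of bidder [i]'s allocation in the social welfare. *)
Definition social_value (i : 'I_n) (u : Ty R n) : R :=
  u.1 - \sum_(j < n | j != i) tnth u.2 j.

Lemma is_cond_exp_social_value i : is_cond_exp (F i) (social_value i) (gfun m i).
Proof.
have H1 : is_cond_exp (F i) fst id.
  have iv : (F i).-integrable setT (EFin \o fst).
    apply: (bounded_ae_integrable (measurable_Tset i) (FT i) _ (@value_norm i)).
    exact: (measurable_fst : measurable_fun setT (fst : Ty R n -> R)).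
  by split => //; split => //; split.
have H2 : is_cond_exp (F i) (fun u => \sum_(j < n | j != i) tnth u.2 j)
    (fun v => \sum_(j < n | j != i) m j i v).
  by apply: is_cond_exp_sum => j; exact: is_cond_exp_ext.
have := is_cond_exp_linear (-1) H2 H1.
have -> : (fun u => -1 * (\sum_(j < n | j != i) tnth u.2 j) + u.1) = social_value i.
  by apply/funext => u; rewrite mulN1r addrC.
have -> // : (fun v => -1 * (\sum_(j < n | j != i) m j i v) + id v) = gfun m i.
by apply/funext => v; rewrite mulN1r addrC.
Qed.

Lemma measurable_cond_ext i j : j != i -> measurable_fun setT (m j i).
Proof. by move=> /Fm[]. Qed.

Lemma measurable_gfun i : measurable_fun setT (gfun m i).
Proof. by have [_ []] := is_cond_exp_social_value i. Qed.

Lemma measurable_win i : measurable_fun setT (fun v => win i v).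
Proof.
apply: measurable_ind; apply: measurable_fun_ler => //; exact: measurable_gfun.
Qed.

Lemma measurable_win_without i j : measurable_fun setT (fun v => win_without i j v).
Proof.
apply: measurable_ind; apply: measurable_fun_ler => //.
by apply: measurable_sum_cond => k /andP[_]; exact: measurable_cond_ext.
Qed.

Lemma measurable_social_value i : measurable_fun setT (social_value i).
Proof.
apply: measurable_funB; first exact: measurable_fst.
by apply: measurable_sum_cond => j _; exact: measurable_ext.
Qed.

Lemma measurable_ext_mul i (c : R -> R) : measurable_fun setT c ->
  measurable_fun setT (fun u : Ty R n => tnth u.2 i * c u.1).
Proof.
move=> mc; apply: measurable_funM; first exact: measurable_ext.
exact: (measurableT_comp mc measurable_fst).
Qed.

Lemma norm_mul_01 (x c M : R) : `|x| <= M -> 0 <= c <= 1 -> `|x * c| <= M.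
Proof.
move=> xM /andP[c0 c1]; rewrite normrM (ger0_norm c0).
by apply: le_trans xM; rewrite ler_piMr.
Qed.

Lemma in_supp_off_others i ti : T i ti -> in_supp_off T (others i) [tuple ti | _ < n].
Proof. by move=> Tti k; rewrite mem_others negbK => /eqP ->; rewrite tnth_mktuple. Qed.

(** Each summand involves a single opponent, so the iterated integral collapses to one integral per
    opponent. *)
Lemma Eothers_affine i ti (a b : R) (phi : 'I_n -> Ty R n -> R) : T i ti ->
  (forall j, measurable_fun setT (phi j)) ->
  (forall j, j != i -> exists M, forall u, T j u -> `|phi j u| <= M) ->
  Eothers F i (fun t => (a - \sum_(j < n | j != i) phi j (tnth t j) - b)%:E) ti =
  (a - \sum_(j < n | j != i) fine (\int[F j]_u (phi j u)%:E) - b)%:E.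
Proof.
move=> Tti mphi bphi.
have iphi j : j != i -> iexp_integrable F (others i)
    (fun t => phi j (tnth t j)) [tuple ti | _ < n].
  move=> ji; have [M phiM] := bphi j ji.
  apply: (bounded_iexp_integrable FT measurable_Tset (M := M)).
  - exact: (measurableT_comp (mphi j) (measurable_tnth j)).
  - by move=> t /(_ j); exact: phiM.
  - exact: in_supp_off_others.
rewrite /Eothers -/(others i).
have -> : (fun t : n.-tuple (Ty R n) => (a - \sum_(j < n | j != i) phi j (tnth t j) - b)%:E) =
    (fun t => (-1 * (\sum_(j < n | j != i) phi j (tnth t j)) + (a - b))%:E).
  by apply/funext => t; congr EFin; rewrite mulN1r addrCA addrA.
rewrite iexp_linear; [|exact: iexp_integrable_sum|exact: iexp_integrable_cst].
rewrite iexp_cst iexp_sum //.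
rewrite (eq_bigr (fun j => (fine (\int[F j]_u (phi j u)%:E))%:E)); last first.
  move=> j ji; rewrite (iexp_coord _ (fun u => (phi j u)%:E)) ?mem_others // fineK //.
  have [M phiM] := bphi j ji; apply: integrable_fin_num => //.
  exact: (bounded_ae_integrable (measurable_Tset j) _ (mphi j) phiM).
by rewrite sumEFin -EFinM -EFinD mulN1r addrCA addrA.
Qed.

Lemma devE (t : n.-tuple (Ty R n)) i th : dev t i (Some th) = truthful (upd t i th).
Proof.
by apply/funext => k; rewrite /dev /truthful tnth_upd; case: ifP.
Qed.

Lemma pick_truthful (t : n.-tuple (Ty R n)) :
  [pick k | truthful t k == None] = None.
Proof. by case: pickP. Qed.

Lemma xM_truthful t j : xM m (truthful t) j = win j (tnth t j).1.
Proof. by rewrite /xM pick_truthful. Qed.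

Lemma xM_abstain t i j : j != i ->
  xM m (dev t i None) j = win_without i j (tnth t j).1.
Proof.
move=> ji.
have none k : (dev t i None k == None) = (k == i) by rewrite /dev; case: (k == i).
rewrite /xM {1}/dev (negbTE ji).
case: pickP => [k|/(_ i)]; rewrite none ?eqxx // => /eqP ->.
by rewrite (eq_card none) card1 eqxx.
Qed.

Lemma tau_ge0 i : 0 <= tau lv uv m i.
Proof.
have /andP[l0 lu] := lvuv i; rewrite /tau; case: pselect => [ex|nex]; last exact: (le_trans l0 lu).
apply: lb_le_inf => // v /= [/andP[lvv _] _]; exact: (le_trans l0 lvv).
Qed.

Lemma tau_le i v : lv i <= v <= uv i -> 0 <= gfun m i v -> tau lv uv m i <= v.
Proof.
move=> lvu gv; rewrite /tau; case: pselect => [ex|nex]; last by case: nex; exists v.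
apply: ge_inf; last by split.
by exists (lv i) => w /= [/andP[]].
Qed.

(** Monotonicity of g_i puts every value with g_i >= 0 above [v]; if there is none, the threshold is
    the top value. *)
Lemma le_tau i v : lv i <= v <= uv i -> gfun m i v < 0 -> v <= tau lv uv m i.
Proof.
move=> /andP[lvv vu] gv; rewrite /tau; case: pselect => [ex|_] //.
apply: lb_le_inf => // w /= [/andP[lw wu] gw].
rewrite leNgt; apply/negP => wv.
by have := le_lt_trans (le_trans gw (gmono lw (ltW wv) vu)) gv; rewrite ltxx.
Qed.

(** At the posted price [tau] the net gain from buying is nonnegative when [v] wins and nonpositive
    when it loses, so the truthful outcome is the better of the two available ones. *)
Lemma tau_optimal i v w : lv i <= v <= uv i ->
  (v - tau lv uv m i) * win i w <= (v - tau lv uv m i) * win i v.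
Proof.
move=> lvu; have /andP[w0 w1] := ind_01 R (0 <= gfun m i w).
rewrite [in leRHS]/ind; case: ifPn => [gv|]; last rewrite -ltNge => gv.
  by rewrite ler_wpM2l // subr_ge0 tau_le.
by rewrite mulr0 mulr_le0_ge0 // subr_le0 le_tau.
Qed.

Lemma tau_utility_ge0 i v : lv i <= v <= uv i -> 0 <= (v - tau lv uv m i) * win i v.
Proof.
move=> lvu; rewrite /ind; case: ifP => gv; last by rewrite mulr0.
by rewrite mulr1 subr_ge0 tau_le.
Qed.

(** * Incentive compatibility and participation *)

Section Implementation.
Variable C : 'I_n -> R.

(** The payment refunds [extcost], which is exactly the expected externality suffered; the
    posted-price utility and [C i] remain. *)
Lemma Vint_bid i th ti : T i ti ->
  Vint F (xM m) (pM lv uv F m C) i (Some th) ti =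
  ((ti.1 - tau lv uv m i) * win i th.1 + C i)%:E.
Proof.
move=> Tti.
transitivity (Eothers F i (fun t => (ti.1 * win i th.1
  - \sum_(j < n | j != i) tnth (tnth t j).2 i * win j (tnth t j).1
  - (tau lv uv m i * win i th.1 - extcost F m i - C i))%:E) ti).
  rewrite /Vint; congr Eothers; apply/funext => t; rewrite devE xM_truthful tnth_upd eqxx.
  rewrite /pM pick_truthful xM_truthful tnth_upd eqxx.
  congr (_ - _ - _)%:E; apply: eq_bigr => j ji.
  by rewrite xM_truthful tnth_upd (negbTE ji).
rewrite (Eothers_affine _ _ (phi := fun j u => tnth u.2 i * win j u.1)) //; first last.
- move=> j ji; exists (ue i j) => u Tu; apply: norm_mul_01 (ind_01 _ _).
  by apply: ext_norm => //; rewrite eq_sym.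
- by move=> j; exact: (measurable_ext_mul i (measurable_win j)).
by congr EFin; rewrite /extcost; ring.
Qed.

(** The outside option does not depend on the type, so a constant transfer [C i] can cover it. *)
Lemma Vint_abstain i ti : T i ti ->
  Vint F (xM m) (pM lv uv F m C) i None ti = (c0 F m i)%:E.
Proof.
move=> Tti.
transitivity (Eothers F i (fun t => (0
  - \sum_(j < n | j != i) tnth (tnth t j).2 i * win_without i j (tnth t j).1 - 0)%:E) ti).
  rewrite /Vint; congr Eothers; apply/funext => t.
  have -> : xM m (dev t i None) i = 0 by rewrite /xM {1}/dev eqxx.
  have -> : pM lv uv F m C (dev t i None) i = 0.
    by rewrite /pM; case: pickP => // /(_ i); rewrite /dev eqxx.
  rewrite mulr0; congr (_ - _ - _)%:E; apply: eq_bigr => j ji.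
  by rewrite xM_abstain.
rewrite (Eothers_affine _ _ (phi := fun j u => tnth u.2 i * win_without i j u.1)) //; first last.
- move=> j ji; exists (ue i j) => u Tu; apply: norm_mul_01 (ind_01 _ _).
  by apply: ext_norm => //; rewrite eq_sym.
- by move=> j; exact: (measurable_ext_mul i (measurable_win_without i j)).
by rewrite sub0r subr0.
Qed.

Lemma mechanism_BNIC : BNIC lv uv le ue F (xM m) (pM lv uv F m C).
Proof.
move=> i ti th Tti Tth; rewrite !Vint_bid // lee_fin lerD2r.
by apply: tau_optimal; case: Tti.
Qed.

Lemma mechanism_IR : (forall i, c0 F m i <= C i) ->
  interimIR lv uv le ue F (xM m) (pM lv uv F m C).
Proof.
move=> cC i ti Tti; rewrite Vint_bid // Vint_abstain // lee_fin.
rewrite -[leLHS]add0r lerD // tau_utility_ge0 //.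
by case: Tti.
Qed.

End Implementation.

Lemma ae_T i : \forall u \ae F i, T i u.
Proof. exact: ae_supp. Qed.

(* Since [m i j >= 0] almost surely, whoever is served when [i] participates is
   served when [i] abstains. *)
Lemma extcost_le i : extcost F m i <= - c0 F m i.
Proof.
rewrite /extcost /c0 opprK; apply: ler_sum => j ji.
have ij : i != j by rewrite eq_sym.
have int_mul (c : R -> R) : measurable_fun setT c -> (forall v, 0 <= c v <= 1) ->
    (F j).-integrable setT (fun u => (tnth u.2 i * c u.1)%:E).
  move=> mc c01; apply: (bounded_ae_integrable (M := ue i j) (measurable_Tset j)) => //.
    exact: measurable_ext_mul.
  by move=> u Tu; apply: norm_mul_01 (c01 _); exact: ext_norm.
have i1 := int_mul _ (measurable_win j) (fun v => ind_01 _ _).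
have i2 := int_mul _ (measurable_win_without i j) (fun v => ind_01 _ _).
rewrite fine_le //; try exact: integrable_fin_num.
have mi0 : \forall u \ae F j, 0 <= m i j u.1.
  apply: is_cond_exp_ge0 (is_cond_exp_ext ij) _.
  by apply: filterS (ae_T j) => u /(ext_bound ij)/andP[].
(* [ae_ge0_le_integral] needs integrands that are nonnegative everywhere, not just almost surely. *)
have abs_int (c : R -> R) : measurable_fun setT c -> (forall v, 0 <= c v <= 1) ->
    (\int[F j]_u (tnth u.2 i * c u.1)%:E = \int[F j]_u `|tnth u.2 i * c u.1|%:E)%E.
  move=> mc c01; apply: ae_eq_integral => //.
  - by apply/measurable_EFinP; exact: measurable_ext_mul.
  - by apply: measurable_norm_EFin; exact: measurable_ext_mul.
  - apply: filterS (ae_T j) => u /(ext_bound ij)/andP[e0 _] _.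
    by rewrite ger0_norm // mulr_ge0 //; have /andP[] := c01 u.1.
rewrite (abs_int _ (measurable_win j) (fun v => ind_01 _ _)).
rewrite (abs_int _ (measurable_win_without i j) (fun v => ind_01 _ _)).
apply: ae_ge0_le_integral => //.
- exact: (measurable_norm_EFin (measurable_ext_mul i (measurable_win j))).
- exact: (measurable_norm_EFin (measurable_ext_mul i (measurable_win_without i j))).
apply: filterS mi0 => u mu _; rewrite lee_fin !normrM ler_wpM2l //.
rewrite !ger0_norm ?ind_ge0 //.
rewrite /ind; case: ifPn => [gu|_]; last by case: ifP.
rewrite ifT //; move: gu; rewrite /gfun subr_ge0; apply: le_trans.
(* The winning condition with [i] present has the extra nonnegative term [m i j]; dropping it gives
   the condition with [i] absent. *)
rewrite [leRHS](bigD1 i) //= -[leLHS]add0r lerD //.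
by under eq_bigl do rewrite andbC.
Qed.

Lemma payment_ge0 t i : 0 <= pM lv uv F m (c0 F m) (truthful t) i.
Proof.
rewrite /pM pick_truthful -addrA addr_ge0 //.
  by rewrite mulr_ge0 ?tau_ge0 // xM_truthful ind_ge0.
by have := extcost_le i; lra.
Qed.

Lemma social_value_norm i u : T i u ->
  `|social_value i u| <= uv i + \sum_(j < n | j != i) ue j i.
Proof.
move=> Tu; apply: (le_trans (ler_normB _ _)); apply: lerD; first exact: value_norm.
apply: (le_trans (ler_norm_sum _ _ _)); apply: ler_sum => j ji.
exact: ext_norm.
Qed.

(** * Interim allocations and expected welfare *)

Section Reallocation.
Variable x : n.-tuple (Ty R n) -> R.
Hypotheses (mx : measurable_fun setT x) (x01 : forall t, 0 <= x t <= 1).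

Lemma Eothers_01 i u : (0 <= Eothers F i (fun t => (x t)%:E) u <= 1)%E.
Proof.
apply/andP; split.
  by apply: iexp_ge0 => t; rewrite lee_fin; have /andP[] := x01 t.
rewrite -[leRHS](iexp_cst F (others i) 1%E [tuple u | _ < n]).
apply: (@le_iexp _ _ F (fun=> setT)) => //.
- by move=> j; exact: probability_setT.
- by move=> t; rewrite lee_fin; have /andP[] := x01 t.
- exact/measurable_EFinP.
- by move=> t _; rewrite lee_fin; have /andP[] := x01 t.
Qed.

Definition interim_alloc i u := fine (Eothers F i (fun t => (x t)%:E) u).

Lemma interim_allocE i u : (interim_alloc i u)%:E = Eothers F i (fun t => (x t)%:E) u.
Proof.
have /andP[x0 x1] := Eothers_01 i u.
by rewrite fineK // ge0_fin_numE // (le_lt_trans x1) // ltry.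
Qed.

Lemma interim_alloc_01 i u : 0 <= interim_alloc i u <= 1.
Proof. by rewrite -!lee_fin interim_allocE Eothers_01. Qed.

Lemma measurable_interim_alloc i : measurable_fun setT (interim_alloc i).
Proof.
apply: measurableT_comp => //; apply: measurable_Eothers; exact/measurable_EFinP.
Qed.

(** [Efull_mul_coord] rests on Tonelli and needs a nonnegative weight, so it is applied to the
    positive and negative parts of [w], and boundedness on the support allows the results to be
    subtracted. *)
Lemma Efull_weighted i (w : Ty R n -> R) (M : R) : measurable_fun setT w ->
  (forall u, T i u -> `|w u| <= M) ->
  Efull F (fun t => (w (tnth t i) * x t)%:E) =
  (\int[F i]_u (w u * interim_alloc i u)%:E)%E.
Proof.
move=> mw wM.
have pos (a : Ty R n -> R) : measurable_fun setT a -> (forall u, 0 <= a u) ->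
    (forall u, T i u -> `|a u| <= M) ->
    [/\ iexp_integrable F (enum 'I_n) (fun t => a (tnth t i) * x t) [tuple ty0 R n | _ < n],
        (F i).-integrable setT (fun u => (a u * interim_alloc i u)%:E) &
    Efull F (fun t => (a (tnth t i) * x t)%:E) =
      (\int[F i]_u (a u * interim_alloc i u)%:E)%E].
  move=> ma a0 aM; split.
  - apply: (bounded_iexp_integrable FT measurable_Tset (M := M)).
    + by apply: measurable_funM => //; exact: (measurableT_comp ma (measurable_tnth i)).
    + by move=> t /(_ i) Ti; apply: norm_mul_01; [exact: aM|exact: x01].
    + by move=> k; rewrite mem_enum.
  - apply: (bounded_ae_integrable (M := M) (measurable_Tset i)) => //.
      by apply: measurable_funM => //; exact: measurable_interim_alloc.
    by move=> u Tu; apply: norm_mul_01; [exact: aM|exact: interim_alloc_01].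
  - under eq_fun do rewrite EFinM.
    rewrite Efull_mul_coord //.
    + by apply: eq_integral => u _; rewrite EFinM interim_allocE.
    + by move=> t; rewrite lee_fin; have /andP[] := x01 t.
    + exact/measurable_EFinP.
have [] := pos (w^\+)%R; [exact: measurable_funrpos|exact: funrpos_ge0| |].
  move=> u Tu; rewrite ger0_norm ?funrpos_ge0 // /funrpos ge_max.
  by rewrite (le_trans (ler_norm _)) ?wM // (le_trans (normr_ge0 (w u))) ?wM.
move=> ip jp Ep.
have [] := pos (w^\-)%R; [exact: measurable_funrneg|exact: funrneg_ge0| |].
  move=> u Tu; rewrite ger0_norm ?funrneg_ge0 // /funrneg ge_max.
  by rewrite (le_trans (ler_norm _)) ?normrN ?wM // (le_trans (normr_ge0 (w u))) ?wM.
move=> im jm Em.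
have wE u : w u = -1 * (w^\-)%R u + (w^\+)%R u.
  by rewrite mulN1r addrC -[in LHS](funrposBneg w).
transitivity (Efull F (fun t =>
    (-1 * ((w^\-)%R (tnth t i) * x t) + (w^\+)%R (tnth t i) * x t)%:E)).
  by congr Efull; apply/funext => t; rewrite wE mulrDl mulrA.
rewrite /Efull iexp_linear // -!/(Efull F _) Ep Em -integralZl // -integralD //; last first.
  exact: integrableZl.
by apply: eq_integral => u _; rewrite -EFinM -EFinD [in RHS]wE mulrDl mulrA.
Qed.

End Reallocation.

Lemma ESW_interim (x : ('I_n -> option (Ty R n)) -> 'I_n -> R) :
  (forall i, measurable_fun setT (fun t : n.-tuple (Ty R n) => x (truthful t) i)) ->
  (forall t i, 0 <= x (truthful t) i <= 1) ->
  ESW F x = (\sum_(i < n) \int[F i]_u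
    (social_value i u * interim_alloc (fun t => x (truthful t) i) i u)%:E)%E.
Proof.
move=> mx x01; rewrite /ESW /Efull iexp_sum; last first.
  move=> i _; apply: (bounded_iexp_integrable FT measurable_Tset
    (M := uv i + \sum_(j < n | j != i) ue j i)).
  - apply: measurable_funM => //.
    exact: (measurableT_comp (measurable_social_value i) (measurable_tnth i)).
  - by move=> t /(_ i) Ti; apply: norm_mul_01; [exact: social_value_norm|exact: x01].
  - by move=> k; rewrite mem_enum.
apply: eq_bigr => i _.
exact: (Efull_weighted (mx i) (x01^~ i) (measurable_social_value i) (@social_value_norm i)).
Qed.

Lemma interim_alloc_xM i u :
  interim_alloc (fun t => xM m (truthful t) i) i u = win i u.1.
Proof.
rewrite /interim_alloc; under eq_fun do rewrite xM_truthful.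
rewrite [X in fine X](iexp_coord_notin F (fun u => (win i u.1)%:E)) ?tnth_mktuple //.
by rewrite -/(others i) mem_others eqxx.
Qed.

Hypothesis Fdens : forall i, has_density (F i).

(* By [countable_gaps], a monotone interim allocation is almost surely a function of the
   value alone, so that the externalities may be replaced by their conditional means. *)
Lemma monotone_alloc_bound i (X : Ty R n -> R) : measurable_fun setT X ->
  (forall u, 0 <= X u <= 1) ->
  (forall u u', T i u -> T i u' -> u.1 < u'.1 -> X u <= X u') ->
  (\int[F i]_u (social_value i u * X u)%:E <=
   \int[F i]_u (social_value i u * win i u.1)%:E)%E.
Proof.
move=> mX X01 monoX.
(* A reference vector of externalities: the lower bounds, with the normalised 0 at [i], so that
   [(v, c)] is a type for every admissible [v]. Any admissible choice would do. *)
pose c : n.-tuple R := [tuple if j == i then 0 else le j i | j < n].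
pose chi v := X (v, c).
have mchi : measurable_fun setT chi.
  apply: (measurableT_comp mX).
  by apply: measurable_fun_pair; [exact: measurable_id|exact: measurable_cst].
have chi01 v : 0 <= chi v <= 1 by exact: X01.
pose D := [set v | exists s s', [/\ T i s, T i s', s.1 = v, s'.1 = v & X s < X s']].
have cD : countable D by exact: (countable_gaps (V := fst)).
have D0 := density_null (Fdens i) cD.
have mD : measurable (fst @^-1` D : set (Ty R n)).
  by apply: measurable_preimage_fst; apply: countable_measurable.
have aeD : \forall u \ae F i, ~ D u.1.
  exists (fst @^-1` D); split => // u /=; exact: contrapT.
have aeX : \forall u \ae F i, X u = chi u.1.
  apply: filterS2 aeD (ae_T i) => u nDu Tu.
  have Tc : T i (u.1, c).
    have [uv1 _] := Tu; split => //=; rewrite /c; split; first by rewrite tnth_mktuple eqxx.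
    move=> j ji; rewrite tnth_mktuple (negbTE ji) lexx.
    by have /andP[_ ->] := leue ji.
  (* If [X] differs at [u] and [(u.1, c)], these two types exhibit a gap at [u.1], which was
     excluded. *)
  have [lt|gt|//] := ltgtP (X u) (chi u.1); case: nDu.
    by exists u, (u.1, c).
  by exists (u.1, c), u.
have -> : (\int[F i]_u (social_value i u * X u)%:E =
    \int[F i]_u (social_value i u * chi u.1)%:E)%E.
  apply: ae_eq_integral => //.
  - apply/measurable_EFinP; apply: measurable_funM => //; exact: measurable_social_value.
  - apply/measurable_EFinP; apply: measurable_funM; first exact: measurable_social_value.
    exact: (measurableT_comp mchi measurable_fst).
  - by apply: filterS aeX => u -> _.
have ce := is_cond_exp_social_value i.
have [_ [_ [ig _]]] := ce.
have w01 v : 0 <= win i v <= 1 by exact: ind_01.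
rewrite (is_cond_exp_mul ce mchi chi01) (is_cond_exp_mul ce (measurable_win i) w01).
have int_g (f : R -> R) : measurable_fun setT f -> (forall v, 0 <= f v <= 1) ->
    (F i).-integrable setT (fun u => (gfun m i u.1 * f u.1)%:E).
  move=> mf f01.
  apply: (integrable_mul_bounded (M := 1) (Z := fun u => gfun m i u.1) _ _ ig).
    exact: (measurableT_comp mf measurable_fst).
  by move=> u; have /andP[f0 f1] := f01 u.1; rewrite ger0_norm.
apply: le_integral => //; [exact: int_g|exact: (int_g _ (measurable_win i))|].
(* The weights are now functions of the value, so the comparison is pointwise: among weights in
   [0,1], the indicator of g_i >= 0 maximises the product with g_i. *)
move=> u _; rewrite lee_fin; have /andP[c0 c1] := chi01 u.1.
rewrite [in leRHS]/ind; case: ifPn => [g0|]; last rewrite -ltNge => g0.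
  by rewrite ler_wpM2l.
by rewrite mulr0 mulr_le0_ge0 // ltW.
Qed.

(** * Optimality among all BNIC mechanisms *)

Section Optimality.
Variables x' p' : ('I_n -> option (Ty R n)) -> 'I_n -> R.
Hypothesis mech : is_mechanism x' p'.
Hypothesis mx' : forall i,
  measurable_fun setT (fun t : n.-tuple (Ty R n) => x' (truthful t) i).
Hypothesis mp' : forall i,
  measurable_fun setT (fun t : n.-tuple (Ty R n) => p' (truthful t) i).
Hypothesis ip' : forall i ti th, T i ti -> T i th ->
  (Eothers F i (fun t => (`|p' (dev t i (Some th)) i|)%:E) ti < +oo)%E.
Hypothesis bnic : BNIC lv uv le ue F x' p'.

Let X i := interim_alloc (fun t => x' (truthful t) i) i.

Let x'01 t i : 0 <= x' (truthful t) i <= 1.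
Proof. by have [] := mech (truthful t) i. Qed.

(** The part of bidder [i]'s utility not multiplied by her value, taken with its sign: externalities
    suffered and payment both enter negatively. *)
Let cost i (t : n.-tuple (Ty R n)) :=
  - (\sum_(j < n | j != i) tnth (tnth t j).2 i * x' (truthful t) j) - p' (truthful t) i.

Lemma cost_integrable i th : T i th ->
  iexp_integrable F (others i) (cost i) [tuple th | _ < n].
Proof.
move=> Tth.
have -> : cost i = fun t =>
    -1 * (\sum_(j < n | j != i) tnth (tnth t j).2 i * x' (truthful t) j) +
    (-1 * p' (truthful t) i + 0).
  by apply/funext => t; rewrite /cost !mulN1r addr0.
apply: iexp_integrable_linear.
  apply: iexp_integrable_sum => j ji; have ij : i != j by rewrite eq_sym.
  apply: (bounded_iexp_integrable FT measurable_Tset (M := ue i j)).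
  - apply: measurable_funM => //.
    exact: (measurableT_comp (measurable_ext i) (measurable_tnth j)).
  - by move=> t /(_ j) Tj; apply: norm_mul_01 => //; exact: ext_norm.
  - exact: in_supp_off_others.
apply: iexp_integrable_linear; last exact: iexp_integrable_cst.
split; first exact: mp'.
(* With the true type equal to the report, the integrability assumption on deviations becomes one at
   the base point [th]. *)
have := ip' Tth Tth; under eq_fun do rewrite devE.
by rewrite (@Eothers_upd _ _ F i (fun t => `|p' (truthful t) i|%:E)).
Qed.

(** For a fixed report the utility is affine in the true value, with slope [X i th] and an intercept
    free of the true type. *)
Lemma Vint_linear i ti th : T i th ->
  Vint F x' p' i (Some th) ti =
  (ti.1 * X i th + fine (Eothers F i (fun t => (cost i t)%:E) th))%:E.
Proof.
move=> Tth.
pose G t := (ti.1 * x' (truthful t) i + cost i t)%:E.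
have -> : Vint F x' p' i (Some th) ti = Eothers F i (fun t => G (upd t i th)) ti.
  rewrite /Vint; congr Eothers; apply/funext => t; rewrite devE /G /cost addrA.
  congr (_ - _ - _)%:E; apply: eq_bigr => j ji.
  by rewrite tnth_upd (negbTE ji).
rewrite (@Eothers_upd _ _ F i G) /G /Eothers -/(others i) iexp_linear; first last.
- exact: cost_integrable.
- apply: (bounded_iexp_integrable FT measurable_Tset (M := 1)) => //.
  + by move=> t _; have /andP[h0 h1] := x'01 t i; rewrite ger0_norm.
  + exact: in_supp_off_others.
rewrite EFinD EFinM interim_allocE // fineK //.
exact: (iexp_fin_num (cost_integrable Tth)).
Qed.

(** Adding the two incentive constraints between [u] and [u'] cancels the intercepts and leaves a
    product whose first factor, the difference of values, is positive. *)
Lemma interim_alloc_mono i u u' : T i u -> T i u' -> u.1 < u'.1 -> X i u <= X i u'.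
Proof.
move=> Tu Tu' lt.
have := bnic Tu Tu'; have := bnic Tu' Tu; rewrite !Vint_linear // !lee_fin.
set c1 := fine _; set c2 := fine _ => H1 H2.
have : 0 <= (u'.1 - u.1) * (X i u' - X i u) by lra.
by rewrite pmulr_rge0 ?subr_gt0 // subr_ge0.
Qed.

Lemma welfare_optimal : (ESW F x' <= ESW F (xM m))%E.
Proof.
rewrite !ESW_interim //; last 2 first.
- move=> i; under eq_fun do rewrite xM_truthful.
  exact: (measurableT_comp (measurable_win i)
    (measurableT_comp measurable_fst (measurable_tnth i))).
- by move=> t i; rewrite xM_truthful; exact: ind_01.
apply: lee_sum => i _.
under [leRHS]eq_integral do rewrite interim_alloc_xM.
apply: monotone_alloc_bound.
- exact: measurable_interim_alloc.
- by move=> u; exact: interim_alloc_01.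
- exact: interim_alloc_mono.
Qed.

End Optimality.

End Market.

Theorem mainTheorem4 (R : realType) (n : nat)
  (lv uv : 'I_n -> R) (le ue : 'I_n -> 'I_n -> R)
  (F : 'I_n -> probability (Ty R n) R)
  (m : 'I_n -> 'I_n -> R -> R) :
  (forall i, 0 <= lv i <= uv i) ->
  (forall i j, j != i -> 0 <= le j i <= ue j i) ->
  (* common prior: F i is supported on the type space T_i *)
  (forall i, F i (Tset lv uv le ue i) = 1%E) ->
  (* v_i has a density *)
  (forall i, has_density (F i)) ->
  (* m j i is (a version of) v |-> E[eta_{j<-i} | v_i = v] *)
  (forall i j, j != i -> cond_exp_version (F i) (fun t => tnth t.2 j) (m j i)) ->
  (* g_i is non-decreasing on [lv_i, uv_i] *)
  (forall i a b, lv i <= a -> a <= b -> b <= uv i -> gfun m i a <= gfun m i b) ->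
  (* (a) *)
  (forall C : 'I_n -> R, (forall i, c0 F m i <= C i) ->
     BNIC lv uv le ue F (xM m) (pM lv uv F m C) /\
     interimIR lv uv le ue F (xM m) (pM lv uv F m C)) /\
  (forall t : n.-tuple (Ty R n), (forall k, Tset lv uv le ue k (tnth t k)) ->
     forall i, 0 <= pM lv uv F m (c0 F m) (truthful t) i) /\
  (* (b) *)
  (forall x' p' : ('I_n -> option (Ty R n)) -> 'I_n -> R,
     is_mechanism x' p' ->
     (forall i, measurable_fun setT (fun t : n.-tuple (Ty R n) => x' (truthful t) i)) ->
     (forall i, measurable_fun setT (fun t : n.-tuple (Ty R n) => p' (truthful t) i)) ->
     (forall i ti th, Tset lv uv le ue i ti -> Tset lv uv le ue i th ->
        (Eothers F i (fun t => (`|p' (dev t i (Some th)) i|)%:E) ti < +oo)%E) ->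
     BNIC lv uv le ue F x' p' ->
     (ESW F x' <= ESW F (xM m))%E).
Proof.
move=> lvuv leue FT Fdens Fm gmono; split; [|split].
- by move=> C cC; split; [exact: mechanism_BNIC|exact: mechanism_IR].
- by move=> t _ i; exact: (payment_ge0 (le := le) (ue := ue)).
- move=> x' p' mech mx mp ip bnic.
  exact: (welfare_optimal lvuv leue FT Fm Fdens mech mx mp ip bnic).
Qed.
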